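(* Let $G=(V,E)$ be any graph with $n=|V|$ vertices and bounded degrees. For any constants $\gamma\in(0,1/2]$ and $\alpha\ge 1$, the maximum load $X_{\max}^{(n)}$ after $n$ balls have been allocated by the local search allocation on $G$ satisfies $$\mathbf{Pr}\left[\,X_{\max}^{(n)}<\frac{\gamma R_1^{(\gamma)}(G)}{4}\,\right]\le n^{-\omega(1)}\qquad\text{and}\qquad \mathbf{Pr}\left[\,X_{\max}^{(n)}\ge 56\,\alpha\,R_1(G)\,\right]\le 5n^{-\alpha}.$$ Explicitly: for every degree bound $\Delta$ and all constants $\gamma\in(0,1/2]$, $\alpha\ge1$ and $A>0$, there is $n_0=n_0(\Delta,\gamma,\alpha,A)$ such that for every graph $G$ with $n\ge n_0$ vertices and maximum degree at most $\Delta$, the first probability is at most $n^{-A}$ and the second is at most $5n^{-\alpha}$.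
   Context: Graphs are finite and undirected, not necessarily connected. $d_G(u,v)$ is the graph distance ($\infty$ if $u,v$ lie in different components) and $B_u^r=\{v\in V: d_G(u,v)\le r\}$. With $\mathbb{N}=\{1,2,\dots\}$ and $\log$ the natural logarithm, define $$R_1(G)=\min\{r\in\mathbb{N}: r\,|B_u^r|\log r\ge \log n\ \text{for all } u\in V\},$$ and, for $\gamma\in(0,1/2]$, $$R_1^{(\gamma)}(G)=\max\{r\in\mathbb{N}:\ \text{there exists } S\subseteq V\text{ with }|S|\ge n^{\frac12+\gamma}\text{ such that } r\,|B_u^r|\log r<\log n\text{ for all }u\in S\}.$$ Local search allocation on $G$: initially all vertices have load $0$. Balls $1,2,\dots$ arrive one at a time. Ball $i$ is born at a vertex $U_i$ (its birthplace) chosen independently and uniformly at random from $V$. Starting at its birthplace, in each step the ball moves to a neighbour of its current vertex having the smallest load among all neighbours, provided that this load is strictly smaller than the load of the current vertex; ties between smallest-load neighbours are broken independently and uniformly at random. The ball stops at the first vertex visited that has no neighbour of strictly smaller load, and it is allocated there, increasing that vertex's load by $1$. Then the next ball arrives. $X_v^{(m)}$ denotes the load of $v$ after $m$ balls have been allocated, and $X_{\max}^{(m)}=\max_{v\in V}X_v^{(m)}$. *)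

(* Defs.v *)
From HB Require Import structures.
From mathcomp Require Import all_boot all_order all_algebra.
From mathcomp Require Import all_classical all_reals all_analysis.

Set Implicit Arguments.
Unset Strict Implicit.
Unset Printing Implicit Defensive.

Import Order.TTheory GRing.Theory Num.Theory.

Local Open Scope ring_scope.

(* A finite simple graph is a symmetric irreflexive relation [e : rel T] on a
   finite vertex type [T]; these two conditions are hypotheses of the theorem. *)
Section Graph.
Variables (T : finType) (e : rel T).

Definition neighbours (u : T) : {set T} := [set v | e u v].

Definition walk (k : nat) (u v : T) : bool :=
  [exists p : k.-tuple T, path e u p && (last u p == v)].

Lemma connect_walk u v : connect e u v -> exists k, walk k u v.
Proof.
move=> /connectP[p ep ->]; exists (size p).
by apply/existsP; exists (in_tuple p); rewrite /= ep eqxx.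
Qed.

(* [None] stands for the infinite distance. *)
Definition dist (u v : T) : option nat :=
  match @idP (connect e u v) with
  | ReflectT uv => Some (ex_minn (connect_walk uv))
  | ReflectF _ => None
  end.

Definition gball (u : T) (r : nat) : {set T} :=
  [set v | if dist u v is Some d then (d <= r)%N else false].

Lemma gball_center u r : u \in gball u r.
Proof.
rewrite inE /dist; case: {-}_ / idP => [uv|/negP]; last by rewrite connect0.
case: ex_minnP => k _ /(_ 0%N) k0; apply: (@leq_trans 0%N) => //; apply: k0.
by apply/existsP; exists [tuple]; rewrite /= eqxx.
Qed.

Lemma card_gball_gt0 u r : (0 < #|gball u r|)%N.
Proof. by apply/card_gt0P; exists u; exact: gball_center. Qed.

End Graph.

Section GraphParameters.
Variables (R : realType) (T : finType) (e : rel T).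

Let n : R := #|T|%:R.
Let size_weight (u : T) (r : nat) : R := r%:R * #|gball e u r|%:R * ln r%:R.

Definition R1_cond (r : nat) : Prop :=
  (0 < r)%N /\ forall u : T, ln n <= size_weight u r.

Definition R1 : nat :=
  xget 0%N [set r | R1_cond r /\ forall s, R1_cond s -> (r <= s)%N]%classic.

Definition R1g_cond (gamma : R) (r : nat) : Prop :=
  (0 < r)%N /\
  exists S : {set T}, n `^ (2^-1 + gamma) <= #|S|%:R
    /\ forall u, u \in S -> size_weight u r < ln n.

Definition R1g (gamma : R) : nat :=
  xget 0%N [set r | R1g_cond gamma r
                    /\ forall s, R1g_cond gamma s -> (s <= r)%N]%classic.

Lemma ln_le_size_weight u r : (0 < #|T|)%N -> (#|T| <= r)%N ->
  ln n <= size_weight u r.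
Proof.
move=> T0 Tr; have r0 : (0 < r)%N by exact: leq_trans Tr.
apply: (@le_trans _ _ (ln r%:R)).
  by rewrite ler_ln ?posrE ?ltr0n// ler_nat.
rewrite /size_weight -natrM ler_peMl ?ln_ge0 ?ler1n//.
by rewrite muln_gt0 r0 card_gball_gt0.
Qed.

Lemma R1P : R1_cond R1 /\ forall s, R1_cond s -> (R1 <= s)%N.
Proof.
have ex : exists r, `[< R1_cond r >].
  exists #|T|.+1; apply/asboolP; split=> // u.
  by apply: ln_le_size_weight => //; apply/card_gt0P; exists u.
apply: (@xgetPex _ 0%N
  [set r | R1_cond r /\ forall s, R1_cond s -> (r <= s)%N]%classic).
case: (ex_minnP ex) => r /asboolP Pr rmin; exists r; split=> // s Ps.
by apply: rmin; apply/asboolP.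
Qed.

Lemma R1gP (gamma : R) : 0 < gamma <= 2^-1 -> (1 < #|T|)%N ->
  R1g_cond gamma (R1g gamma)
  /\ forall s, R1g_cond gamma s -> (s <= R1g gamma)%N.
Proof.
move=> /andP[g0 g1] T1; have T0 : (0 < #|T|)%N by exact: ltnW.
have ex : exists r, `[< R1g_cond gamma r >].
  exists 1%N; apply/asboolP; split=> //; exists [set: T]; split.
    rewrite cardsT -[leRHS]powRr1 ?ler0n//; apply: ler_powR; rewrite ?ler1n//.
    by rewrite [leRHS](splitr 1) mul1r lerD2l.
  by move=> u _; rewrite /size_weight ln1 mulr0 ln_gt0// ltr1n.
have ub r : `[< R1g_cond gamma r >] -> (r <= #|T|)%N.
  move=> /asboolP[_ [S [ST Sr]]].
  have /card_gt0P[u uS] : (0 < #|S|)%N.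
    by rewrite -(ltr0n R); apply: lt_le_trans ST; rewrite powR_gt0 ?ltr0n.
  rewrite leqNgt; apply/negP => /ltnW Tr.
  by have := Sr u uS; rewrite ltNge ln_le_size_weight.
apply: (@xgetPex _ 0%N [set r | R1g_cond gamma r
  /\ forall s, R1g_cond gamma s -> (s <= r)%N]%classic).
case: (ex_maxnP ex ub) => r /asboolP Pr rmax; exists r; split=> // s Ps.
by apply: rmax; apply/asboolP.
Qed.

End GraphParameters.

(* Finitely supported distributions as lists of weighted outcomes; [dbind]
   makes the next random choice from a law depending on the outcome so far. *)
Section Distributions.
Variable R : realType.

Definition fdist (A : Type) : Type := seq (R * A).

Definition dret A (a : A) : fdist A := [:: (1, a)].

Definition dunif (T : finType) (S : {set T}) : fdist T :=
  [seq (#|S|%:R^-1, a) | a <- enum S].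

Definition dbind A B (d : fdist A) (f : A -> fdist B) : fdist B :=
  flatten [seq [seq (p.1 * q.1, q.2) | q <- f p.2] | p <- d].

Definition Pr A (d : fdist A) (E : pred A) : R := \sum_(p <- d | E p.2) p.1.

Lemma Pr_ret A (a : A) E : Pr (dret a) E = (E a)%:R.
Proof. by rewrite /Pr big_mkcond big_seq1; case: (E a). Qed.

Lemma Pr_bind A B (d : fdist A) (f : A -> fdist B) E :
  Pr (dbind d f) E = \sum_(p <- d) p.1 * Pr (f p.2) E.
Proof.
rewrite /Pr /dbind big_flatten big_map; apply: eq_bigr => p _.
by rewrite big_map mulr_sumr.
Qed.

Lemma Pr_unif (T : finType) (S : {set T}) E :
  Pr (dunif S) E = #|[set a in S | E a]|%:R / #|S|%:R.
Proof.
rewrite /Pr /dunif big_map big_enum_cond /= sumr_const mulrC mulr_natr.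
by congr (_ *+ _); apply: eq_card => a; rewrite !inE.
Qed.

End Distributions.

Section LocalSearch.
Variables (R : realType) (T : finType) (e : rel T).

Definition loads : Type := {ffun T -> nat}.

(* The vertices a ball at [v] may move to: the neighbours of smallest load,
   provided that this load is strictly smaller than the load of [v]. *)
Definition next_vertices (x : loads) (v : T) : {set T} :=
  [set w in neighbours e v | (x w < x v)%N
                             && [forall z in neighbours e v, (x w <= x z)%N]].

Fixpoint search (x : loads) (k : nat) (v : T) : fdist R T :=
  if k is k'.+1 then
    if next_vertices x v == finset.set0 then dret R v
    else dbind (dunif R (next_vertices x v)) (search x k')
  else dret R v.

(* The load decreases at each move, so a ball at [v] makes at most [x v] moves
   and the bound on their number is never active; see [local_searchE]. *)
Definition local_search (x : loads) (v : T) : fdist R T := search x (x v) v.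

Lemma next_vertices0 (x : loads) v : x v = 0%N -> next_vertices x v = finset.set0.
Proof. by move=> xv; apply/setP => w; rewrite !inE xv ltn0 andbF. Qed.

Lemma search_enough (x : loads) k v :
  (x v <= k)%N -> search x k v = local_search x v.
Proof.
rewrite /local_search => xvk.
suff H m l w : (x w <= m)%N -> (x w <= l)%N -> search x m w = search x l w.
  exact: H.
elim: m l w => [|m IH] [|l] w //=; rewrite ?leqn0.
- by move=> /eqP xw _; rewrite next_vertices0// eqxx.
- by move=> _ /eqP xw; rewrite next_vertices0// eqxx.
move=> xm xl; case: ifP => // _; rewrite /dbind /dunif -!map_comp.
congr flatten; apply/eq_in_map => z; rewrite mem_enum !inE => /and3P[_ xz _] /=.
by rewrite (IH l z)// -ltnS (leq_trans xz).
Qed.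

Lemma local_searchE (x : loads) v :
  local_search x v =
  if next_vertices x v == finset.set0 then dret R v
  else dbind (dunif R (next_vertices x v)) (local_search x).
Proof.
rewrite -(search_enough (leqnSn (x v))) /=; case: ifP => // _.
rewrite /dbind /dunif -!map_comp; congr flatten; apply/eq_in_map => z.
rewrite mem_enum !inE => /and3P[_ xz _] /=.
by rewrite search_enough// ltnW.
Qed.

Definition add_ball (x : loads) (v : T) : loads :=
  [ffun u => (x u + (u == v))%N].

Definition allocate (x : loads) : fdist R loads :=
  dbind (dunif R [set: T]) (fun u =>
  dbind (local_search x u) (fun v => dret R (add_ball x v))).

Fixpoint loads_after (m : nat) : fdist R loads :=
  if m is m'.+1 then dbind (loads_after m') allocate
  else dret R [ffun=> 0%N].

Definition max_load (x : loads) : nat := \max_(v : T) x v.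

Lemma Pr_local_searchT (x : loads) v : Pr (local_search x v) predT = 1.
Proof.
rewrite /local_search; move: (x v) => k; elim: k v => [|k IH] w /=; first by rewrite Pr_ret.
case: ifPn => [_|M0]; first by rewrite Pr_ret.
rewrite Pr_bind; under eq_bigr do rewrite IH mulr1.
have -> : \sum_(p <- dunif R (next_vertices x w)) p.1
          = Pr (dunif R (next_vertices x w)) predT by [].
rewrite Pr_unif; have -> : [set a in next_vertices x w | predT a]
  = next_vertices x w by apply/setP => a; rewrite !inE andbT.
by rewrite divff// pnatr_eq0 cards_eq0.
Qed.

Lemma Pr_loads_afterT m : (0 < #|T|)%N -> Pr (loads_after m) predT = 1.
Proof.
move=> T0; elim: m => [|m IH] /=; first by rewrite Pr_ret.
rewrite Pr_bind -[RHS]IH; apply: eq_bigr => p _.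
suff -> : Pr (allocate p.2) predT = 1 by rewrite mulr1.
rewrite Pr_bind (eq_bigr (fun q : R * T => q.1)) => [|q _].
  have -> : \sum_(p <- dunif R [set: T]) p.1 = Pr (dunif R [set: T]) predT by [].
  rewrite Pr_unif; have -> : [set a in [set: T] | predT a] = [set: T].
    by apply/setP => a; rewrite !inE.
  by rewrite divff// pnatr_eq0 cardsT -lt0n.
rewrite Pr_bind (eq_bigr (fun s : R * T => s.1)) => [|s _].
  have -> : \sum_(s <- local_search p.2 q.2) s.1
            = Pr (local_search p.2 q.2) predT by [].
  by rewrite Pr_local_searchT mulr1.
by rewrite Pr_ret mulr1.
Qed.

End LocalSearch.

(* Main.v *)
(* Both tails compare the loads with the births.

   Upper tail.  Fix a vertex u, put rho = R_1 and let Z_v = rho ^ (X_v - d(u,v)).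
   A move of a ball goes from v to a neighbour of smaller load, so it cannot
   increase Z; hence the k-th elementary symmetric polynomial of the Z_v, with
   k = |B_u^rho|, grows in expectation by a factor of at most
   1 + k (rho - 1) / n per ball, as if balls stayed at their birthplaces.  It
   starts below e^2 because rho is at least twice the degrees.  Loads of
   neighbours differ by at most 1, so X_u >= l forces X_v >= l - rho on B_u^rho,
   and the single term indexed by B_u^rho is at least rho ^ (k (l - 2 rho)).
   Markov's inequality gives a bound exp (- c k rho log rho) <= n ^ (- c).

   Lower tail.  While all loads are at most l, a ball makes at most l moves, so
   more than l |B_u^s| births within distance s - l of u force a load above l.
   One of two choices of radii makes this have probability at least n ^ (- gamma)
   for each u in S.  At least n ^ (1/4 + gamma) points of S have disjoint balls,
   and the probability that none of these events occurs is at most e n times what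
   it would be if the births were independent Poisson variables. *)
Require Import Defs.
From mathcomp Require Import all_boot all_order all_algebra.
From mathcomp Require Import all_classical all_reals all_analysis.
From mathcomp Require Import perm.
From mathcomp Require Import zify ring lra.

Set Implicit Arguments.
Unset Strict Implicit.
Unset Printing Implicit Defensive.

Import Order.TTheory GRing.Theory Num.Theory.
Local Open Scope ring_scope.

(** * Balls in the graph metric *)

Section Balls.
Variables (T : finType) (e : rel T).

Lemma gballP u v r :
  reflect (exists p, [/\ path e u p, last u p = v & (size p <= r)%N])
          (v \in gball e u r).
Proof.
rewrite inE /dist; case: {-}_ / idP => [uv|nuv]; last first.
  by constructor=> -[p [ep lp _]]; apply: nuv; apply/connectP; exists p.
apply: (iffP idP); case: ex_minnP => m /existsP ew mmin.
  case: ew => p /andP[ep /eqP lp] mr.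
  by exists p; rewrite size_tuple.
move=> [q [eq lq qr]]; apply: leq_trans qr; apply: mmin.
by apply/existsP; exists (in_tuple q); rewrite /= eq lq eqxx.
Qed.

Lemma mem_gballE u v r :
  (v \in gball e u r) = if dist e u v is Some d then (d <= r)%N else false.
Proof. by rewrite inE. Qed.

Lemma gballS u r s : (r <= s)%N -> gball e u r \subset gball e u s.
Proof.
move=> rs; apply/fintype.subsetP => v /gballP[p [ep lp pr]].
by apply/gballP; exists p; split=> //; apply: leq_trans rs.
Qed.

Lemma gball_trans u v w r s :
  v \in gball e u r -> w \in gball e v s -> w \in gball e u (r + s).
Proof.
move=> /gballP[p [ep lp pr]] /gballP[q [eq lq qr]].
apply/gballP; exists (p ++ q); rewrite cat_path ep lp eq last_cat lp lq size_cat.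
by split=> //; apply: leq_add.
Qed.

Lemma gball_edge u v : e u v -> v \in gball e u 1.
Proof. by move=> uv; apply/gballP; exists [:: v]; rewrite /= uv. Qed.

Lemma gball0 u : gball e u 0 = [set u].
Proof.
apply/setP => v; rewrite finset.in_set1; apply/gballP/eqP => [[p [_ <-]]|->].
  by rewrite leqn0 size_eq0 => /eqP->.
by exists [::].
Qed.

Lemma gball_sym (se : symmetric e) u v r :
  v \in gball e u r -> u \in gball e v r.
Proof.
move=> /gballP[p [ep lp pr]]; apply/gballP; exists (rev (belast u p)).
rewrite -lp rev_path (eq_path (e' := e)) => [|x y]; last by rewrite se.
split=> //; last by rewrite size_rev size_belast.
by case: p {ep lp pr} => //= x p; rewrite rev_cons last_rcons.
Qed.

(** The degree bound is strict, so a vertex together with its neighbours counts at most [D], the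
    factor gained per unit of radius. *)
Lemma card_gball_le (D : nat) :
  (forall v : T, (#|neighbours e v| < D)%N) ->
  forall u r, (#|gball e u r| <= D ^ r)%N.
Proof.
move=> dD u; elim=> [|r IH]; first by rewrite gball0 cards1.
have sub : gball e u r.+1 \subset
    \bigcup_(v in gball e u r) (v |: neighbours e v).
  apply/fintype.subsetP => w /gballP[p]; case/lastP: p => [[_ /= <- _]|p w'].
    by apply/finset.bigcupP; exists u; rewrite ?gball_center// setU11.
  rewrite rcons_path last_rcons size_rcons ltnS => -[/andP[ep pw] <- pr].
  apply/finset.bigcupP; exists (last u p); first by apply/gballP; exists p.
  by rewrite !inE pw orbT.
apply: leq_trans (subset_leq_card sub) _.
have bnd : (#|\bigcup_(v in gball e u r) (v |: neighbours e v)|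
    <= \sum_(v in gball e u r) D)%N.
  elim/big_rec2: _ => [|v m A _ IHv]; first by rewrite cards0.
  apply: leq_trans (leq_card_setU _ _) _; apply: leq_add => //.
  by rewrite cardsU1; apply: leq_trans (dD v); case: (v \notin _).
by apply: leq_trans bnd _; rewrite sum_nat_const expnSr leq_mul2r IH orbT.
Qed.

End Balls.

(** * Expectations under finitely supported laws *)

Section Expectation.
Variable R : realType.

Definition Ex A (d : fdist R A) (f : A -> R) : R := \sum_(p <- d) p.1 * f p.2.

Lemma PrE A (d : fdist R A) E : Pr d E = Ex d (fun a => (E a)%:R).
Proof.
rewrite /Pr /Ex big_mkcond; apply: eq_bigr => p _.
by case: (E p.2); rewrite ?mulr1 ?mulr0.
Qed.

Lemma Ex_ret A (a : A) f : Ex (dret R a) f = f a.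
Proof. by rewrite /Ex big_seq1 mul1r. Qed.

Lemma Ex_bind A B (d : fdist R A) (g : A -> fdist R B) f :
  Ex (dbind d g) f = Ex d (fun a => Ex (g a) f).
Proof.
rewrite /Ex /dbind big_flatten big_map; apply: eq_bigr => p _.
by rewrite big_map mulr_sumr; apply: eq_bigr => q _; rewrite mulrA.
Qed.

Lemma Ex_unif (T : finType) (S : {set T}) f :
  Ex (dunif R S) f = (\sum_(a in S) f a) / #|S|%:R.
Proof.
by rewrite /Ex /dunif big_map big_enum mulr_suml;
  apply: eq_bigr => a _; rewrite mulrC.
Qed.

Lemma Ex_sum A (I : finType) (d : fdist R A) (f : I -> A -> R) :
  Ex d (fun a => \sum_i f i a) = \sum_i Ex d (f i).
Proof.
by rewrite /Ex exchange_big; apply: eq_bigr => p _; rewrite mulr_sumr.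
Qed.

Lemma ExZ A (d : fdist R A) c f : Ex d (fun a => c * f a) = c * Ex d f.
Proof.
by rewrite /Ex mulr_sumr; apply: eq_bigr => p _; rewrite mulrCA.
Qed.

End Expectation.

Lemma sum_eq_mem (T : finType) (A : {set T}) w :
  (\sum_(v in A) (v == w) = (w \in A))%N.
Proof.
rewrite big_mkcond (bigD1 w)//= eqxx big1 ?addn0 => [|v /negPf->];
  last by case: ifP.
by case: ifP.
Qed.

(** * Possible stopping vertices and worst-case bounds *)

Section Process.
Variables (R : realType) (T : finType) (e : rel T).

Definition downhill (x : loads T) : rel T := fun v w => e v w && (x w < x v)%N.

Definition local_min (x : loads T) (w : T) : Prop :=
  forall z, e w z -> (x w <= x z)%N.

(** Keeps of a search only what the two tails use: a strictly decreasing path of bounded length that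
    ends at a local minimum. Tie-breaking is forgotten. *)
Definition stops (x : loads T) (v w : T) : Prop :=
  (exists p, [/\ path (downhill x) v p, last v p = w & (size p <= x v)%N])
  /\ local_min x w.

Lemma next_vertices_eq0 (x : loads T) v :
  next_vertices e x v = finset.set0 -> local_min x v.
Proof.
move=> M0 z vz; rewrite leqNgt; apply/negP => zv.
pose P w := e v w && (x w < x v)%N.
have Pz : P z by rewrite /P vz.
case: (@arg_minnP _ z P x Pz) => w /andP[vw wv] wmin.
suff : w \in next_vertices e x v by rewrite M0 inE.
rewrite !inE vw wv; apply/forall_inP => y; rewrite inE => vy.
case: (ltnP (x y) (x v)) => [yv|]; last by move/(leq_trans (ltnW wv)).
by apply: wmin; rewrite /P vy.
Qed.

Lemma Ex_local_search_le (x : loads T) v f c :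
  (forall w, stops x v w -> f w <= c) -> Ex (local_search R e x v) f <= c.
Proof.
rewrite /local_search /stops.
have: (x v <= x v)%N by []. move: {2 3 4}(x v) => k.
elim: k v => [|k IH] v /= xk H.
  rewrite Ex_ret; apply: H; split; first by exists [::].
  by move=> z _; move: xk; rewrite leqn0 => /eqP->.
case: ifPn => [/eqP M0|M0].
  rewrite Ex_ret; apply: H; split; first by exists [::].
  exact: next_vertices_eq0.
rewrite Ex_bind Ex_unif ler_pdivrMr ?ltr0n ?card_gt0//.
rewrite mulr_natr -sumr_const; apply: ler_sum => w.
rewrite !inE => /and3P[vw wv _]; apply: IH.
  by rewrite -ltnS (leq_trans wv).
move=> y [[p [pp lp sp]] my]; apply: H; split=> //.
by exists (w :: p); rewrite /= /downhill vw wv.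
Qed.

(** Only the birthplace is averaged; the search is bounded by its worst outcome. *)
Lemma Ex_allocate_le (x : loads T) f (g : T -> R) :
  (forall v w, stops x v w -> f (add_ball x w) <= g v) ->
  Ex (allocate R e x) f <= (\sum_v g v) / #|T|%:R.
Proof.
move=> H; rewrite Ex_bind Ex_unif cardsT.
rewrite (eq_bigl predT) => [|v]; last by rewrite finset.in_setT.
rewrite ler_wpM2r ?invr_ge0//; apply: ler_sum => v _.
rewrite Ex_bind; apply: Ex_local_search_le => w vw; rewrite Ex_ret; exact: H.
Qed.

(* The process conditioned on its first ball, where [loads_after] conditions on
   the last one. *)
Fixpoint run (s : nat) (x : loads T) (f : loads T -> R) : R :=
  if s is s'.+1 then Ex (allocate R e x) (fun y => run s' y f) else f x.

Lemma Ex_loads_after m f :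
  Ex (loads_after R e m) f = run m [ffun=> 0%N] f.
Proof.
suff H s : Ex (loads_after R e m) (fun x => run s x f)
    = run (m + s)%N [ffun=> 0%N] f by rewrite -[m in RHS]addn0 -H.
elim: m s => [|m IH] s; first by rewrite Ex_ret.
by rewrite addSnnS -IH Ex_bind.
Qed.

Lemma stops_gball (x : loads T) v w : stops x v w -> w \in gball e v (x v).
Proof.
move=> [[p [pp lp sp]] _]; apply/gballP; exists p; split=> //.
by apply: sub_path pp => a b /andP[].
Qed.

End Process.

(** * Upper tail *)

Section SubsetProducts.
Variables (R : realType) (T : finType).

(** Sets containing both points occur on both sides. The transposition of [v] and [w] maps the other
    sets on the left to those on the right and replaces the factor [z w] by [z v]. *)
Lemma subset_products_le (z : T -> R) k v w :
  (forall a, 0 <= z a) -> z w <= z v ->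
  \sum_(A : {set T} | (#|A| == k) && (w \in A)) \prod_(a in A) z a
    <= \sum_(A : {set T} | (#|A| == k) && (v \in A)) \prod_(a in A) z a.
Proof.
move=> z0 zwv; rewrite (bigID (fun A : {set T} => v \in A)) /=.
rewrite [leRHS](bigID (fun A : {set T} => w \in A)) /=; apply: lerD.
  by rewrite (eq_bigl _ _ (fun A => andbAC _ _ _)).
have hI : injective (fun A : {set T} => [set tperm v w a | a in A]).
  exact: imset_inj (@perm_inj _ _).
rewrite [leRHS](reindex_inj hI) /=.
have memt (A : {set T}) a : (tperm v w a \in [set tperm v w b | b in A]) = (a \in A).
  exact: (finset.mem_imset _ _ (@perm_inj _ _)).
rewrite [leRHS](eq_bigl (fun A : {set T} =>
    [&& #|A| == k, w \in A & v \notin A])) => [|A]; last first.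
  rewrite card_imset; last exact: perm_inj.
  by have := memt A w; have := memt A v; rewrite tpermR tpermL => -> ->;
    rewrite andbA.
rewrite (eq_bigl (fun A : {set T} => [&& #|A| == k, w \in A & v \notin A])) => [|A];
  last by rewrite andbA.
apply: ler_sum => A /and3P[_ wA vA].
rewrite big_imset => [|a b _ _]; last exact: perm_inj.
apply: ler_prod => a aA; rewrite z0 /=.
by case: tpermP => [av|->//|//]; rewrite -av aA in vA.
Qed.

Lemma sum_subset_products (z : T -> R) k :
  \sum_v \sum_(A : {set T} | (#|A| == k) && (v \in A)) \prod_(a in A) z a
    = k%:R * \sum_(A : {set T} | #|A| == k) \prod_(a in A) z a.
Proof.
under eq_bigr do rewrite big_mkcondr.
rewrite exchange_big mulr_sumr; apply: eq_bigr => A /eqP Ak.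
by rewrite -big_mkcond sumr_const Ak mulr_natl.
Qed.

(** These products are among the terms of the expanded [\prod_a (z a + 1)]. *)
Lemma subset_products_le_expR (z : T -> R) k : (forall a, 0 <= z a) ->
  \sum_(A : {set T} | #|A| == k) \prod_(a in A) z a <= expR (\sum_a z a).
Proof.
move=> z0; rewrite expR_sum; apply: le_trans (_ : \prod_a (z a + 1) <= _).
  rewrite bigA_distr [leRHS](bigID (fun A : {set T} => #|A| == k)) /=.
  rewrite ler_wpDr//.
    apply: sumr_ge0 => A _; apply: prodr_ge0 => a _.
    by case: ifP.
  by apply: ler_sum => A _; rewrite [leLHS]big_mkcond.
apply: ler_prod => a _; rewrite addr_ge0//= addrC; exact: expR_ge1Dx.
Qed.

End SubsetProducts.

Section ExpectationMonotone.
Variables (R : realType) (T : finType) (e : rel T).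

Lemma Ex_allocate_mono (x : loads T) f g :
  (forall v w, stops e x v w -> f (add_ball x w) <= g (add_ball x w)) ->
  Ex (allocate R e x) f <= Ex (allocate R e x) g.
Proof.
move=> fg; rewrite -subr_le0.
have -> : Ex (allocate R e x) f - Ex (allocate R e x) g
    = Ex (allocate R e x) (fun y => f y - g y).
  by rewrite /Ex -sumrB; apply: eq_bigr => p _; rewrite mulrBr.
rewrite (le_trans (@Ex_allocate_le R T e x _ (fun=> 0) _))//.
  by move=> v w vw; rewrite subr_le0; apply: fg vw.
by rewrite big1// mul0r.
Qed.

(** Later [f] is the indicator of a high load, [g] the rescaled potential and [I] the Lipschitz
    property of the loads. *)
Lemma run_le_geometric (I : loads T -> Prop) (f g : loads T -> R) (q : R) :
  0 <= q ->
  (forall x v w, I x -> stops e x v w -> I (add_ball x w)) ->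
  (forall x, Ex (allocate R e x) g <= q * g x) ->
  (forall x, I x -> f x <= g x) ->
  forall s x, I x -> run e s x f <= q ^+ s * g x.
Proof.
move=> q0 Iadd gq fg; elim=> [|s IH] x Ix /=; first by rewrite expr0 mul1r fg.
apply: le_trans (_ : Ex (allocate R e x) (fun y => q ^+ s * g y) <= _).
  by apply: Ex_allocate_mono => v w vw; apply: IH; apply: Iadd vw.
by rewrite ExZ exprSr -mulrA ler_wpM2l// exprn_ge0.
Qed.

End ExpectationMonotone.

(** * The exponential potential around a vertex *)

Section UpperBound.
Variables (R : realType) (T : finType) (e : rel T).
Hypothesis se : symmetric e.

Definition lipschitz (x : loads T) : Prop :=
  forall v w, e v w -> (x v <= x w + 1)%N.

(** The critical case is [a = w]: the ball stops at a local minimum, so the raised load exceeds a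
    neighbouring load by at most 1. *)
Lemma lipschitz_add_ball (x : loads T) v w :
  lipschitz x -> stops e x v w -> lipschitz (add_ball x w).
Proof.
move=> lx [_ mw] a b ab; rewrite !ffunE.
have := lx a b ab; case: (eqVneq a w) => [aw|_]; last by case: (b == w) => /=; lia.
by subst a; have := mw b ab; case: (b == w) => /=; lia.
Qed.

Lemma lipschitz_gball (x : loads T) u v r :
  lipschitz x -> v \in gball e u r -> (x u <= x v + r)%N.
Proof.
move=> lx /gballP[p [ep <- pr]].
suff : (x u <= x (last u p) + size p)%N by lia.
elim: p u ep {pr} => [|w p IH] u /=; first by rewrite addn0.
by move=> /andP[uw wp]; have := lx u w uw; have := IH w wp; lia.
Qed.

Variable rho : R.
Hypothesis rho1 : 1 <= rho.

Definition weight (u v : T) : R :=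
  if dist e u v is Some d then rho ^- d else 0.

Let rho0 : 0 < rho. Proof. exact: lt_le_trans rho1. Qed.

Let rhoX_ge0 m : 0 <= rho ^+ m. Proof. by rewrite exprn_ge0// ltW. Qed.

Let rhoV_ge0 m : 0 <= rho ^- m. Proof. by rewrite invr_ge0. Qed.

Lemma weight_ge0 u v : 0 <= weight u v.
Proof.
by rewrite /weight; case: dist => // d; exact: rhoV_ge0.
Qed.

Lemma weight_edge u v w : e v w -> weight u w <= rho * weight u v.
Proof.
move=> vw; rewrite /weight; case Ew: (dist e u w) => [d|]; last first.
  by rewrite mulr_ge0 ?weight_ge0// ltW.
have : v \in gball e u (d + 1).
  apply: (@gball_trans _ _ u w); first by rewrite mem_gballE Ew.
  by apply: gball_edge; rewrite se.
rewrite mem_gballE; case: (dist e u v) => // d' dd'.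
rewrite -[leLHS](mulVKf (lt0r_neq0 rho0)) ler_pM2l// -invfM -exprS.
rewrite lef_pV2 ?posrE ?exprn_gt0//; apply: ler_weXn2l => //.
by rewrite -addn1.
Qed.

Lemma weight_gball u v r : v \in gball e u r -> rho ^- r <= weight u v.
Proof.
rewrite mem_gballE /weight; case: (dist e u v) => // d dr.
by rewrite lef_pV2 ?posrE ?exprn_gt0//; apply: ler_weXn2l.
Qed.

(** Counting a vertex in every ball that contains it bounds the sum by a geometric series of ratio
    [D / rho <= 1 / 2]. *)
Lemma sum_weight_le2 (D : nat) u : (0 < D)%N ->
  (forall v, (#|neighbours e v| < D)%N) -> 2 * D%:R <= rho ->
  \sum_v weight u v <= 2.
Proof.
move=> D0 dD Drho.
pose N := (\max_v (if dist e u v is Some d then d else 0)).+1.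
have Nd v d : dist e u v = Some d -> (d < N)%N.
  move=> uv; rewrite ltnS.
  by have /= := @leq_bigmax _ (fun v => if dist e u v is Some d then d else 0%N) v;
    rewrite uv.
apply: le_trans (_ : \sum_(r < N) #|gball e u r|%:R * rho ^- r <= _).
  have -> : \sum_(r < N) #|gball e u r|%:R * rho ^- r
      = \sum_v \sum_(r < N | v \in gball e u r) rho ^- r.
    rewrite (exchange_big_dep predT)//=; apply: eq_bigr => r _.
    by rewrite sumr_const mulr_natl.
  apply: ler_sum => v _; rewrite /weight; case uv: (dist e u v) => [d|].
    rewrite (bigD1 (Ordinal (Nd _ _ uv))) ?mem_gballE ?uv//= ler_wpDr//.
    by apply: sumr_ge0 => r _; exact: rhoV_ge0.
  by apply: sumr_ge0 => r _; exact: rhoV_ge0.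
apply: le_trans (_ : \sum_(r < N) 2^-1 ^+ r <= _).
  apply: ler_sum => r _; apply: le_trans (_ : D%:R ^+ r * rho ^- r <= _).
    rewrite ler_wpM2r ?rhoV_ge0// -natrX ler_nat.
    exact: card_gball_le.
  rewrite -exprVn -exprMn; apply: lerXn2r; rewrite ?nnegrE//.
    by rewrite mulr_ge0// invr_ge0 ltW.
  by rewrite ler_pdivrMr//; move: Drho; lra.
have : (1 - 2^-1) * \sum_(r < N) 2^-1 ^+ r = 1 - 2^-1 ^+ N :> R.
  by rewrite -opprB mulNr -subrX1 opprB.
have : 0 <= 2^-1 ^+ N :> R by rewrite exprn_ge0.
lra.
Qed.

(** This is [Z_v]; the product form avoids negative exponents and gives 0 at infinite distance. *)
Definition tilted (u : T) (x : loads T) (v : T) : R := weight u v * rho ^+ x v.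

Lemma tilted_ge0 u x v : 0 <= tilted u x v.
Proof. by rewrite mulr_ge0 ?weight_ge0. Qed.

(* A move loses one unit of load and gains at most one unit of proximity to [u],
   so it never increases the tilted load. *)
Lemma tilted_stops u x v w : stops e x v w -> tilted u x w <= tilted u x v.
Proof.
move=> [[p [pp <- _]] _]; elim: p v pp => //= w' p IH v /andP[/andP[vw wv] wp].
apply: le_trans (IH _ wp) _.
apply: le_trans (_ : rho * weight u v * rho ^+ x w' <= _).
  by rewrite ler_wpM2r ?rhoX_ge0//; exact: weight_edge.
rewrite mulrAC -exprS mulrC ler_wpM2l ?weight_ge0//; exact: ler_weXn2l.
Qed.

(** The [k]-th elementary symmetric polynomial of the tilted loads. *)
Definition potential (u : T) (k : nat) (x : loads T) : R :=
  \sum_(A : {set T} | #|A| == k) \prod_(v in A) tilted u x v.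

Lemma potential_add_ball u k x w :
  potential u k (add_ball x w) = potential u k x + (rho - 1) *
    \sum_(A : {set T} | (#|A| == k) && (w \in A)) \prod_(v in A) tilted u x v.
Proof.
rewrite /potential mulr_sumr [X in _ + X]big_mkcondr -big_split /=.
apply: eq_bigr => A _.
have -> : \prod_(v in A) tilted u (add_ball x w) v
    = (\prod_(v in A) tilted u x v) * rho ^+ (w \in A).
  rewrite (eq_bigr (fun v => tilted u x v * rho ^+ (v == w))) => [|v _].
    by rewrite big_split /= prodrXr sum_eq_mem.
  by rewrite /tilted ffunE exprD mulrA.
by case: (w \in A); rewrite ?expr1 ?expr0; ring.
Qed.

(** By [subset_products_le] and [tilted_stops], the increment at the stopping vertex is at most the
    one at the birthplace. Summing over birthplaces counts each [k]-set [k] times. *)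
Lemma Ex_allocate_potential u k x : (0 < #|T|)%N ->
  Ex (allocate R e x) (potential u k)
    <= (1 + k%:R * (rho - 1) / #|T|%:R) * potential u k x.
Proof.
move=> T0; pose f v := \sum_(A : {set T} | (#|A| == k) && (v \in A))
  \prod_(a in A) tilted u x a.
apply: le_trans (@Ex_allocate_le R T e x _
  (fun v => potential u k x + (rho - 1) * f v) _) _.
  move=> v w vw; rewrite potential_add_ball lerD2l ler_wpM2l ?subr_ge0//.
  apply: subset_products_le; [exact: tilted_ge0|exact: tilted_stops].
rewrite big_split /= sumr_const -mulr_sumr sum_subset_products cardT.
rewrite -/(potential u k x) -cardT -[_ *+ _]mulr_natr.
have n0 : (#|T|%:R : R) != 0 by rewrite pnatr_eq0 -lt0n.
by rewrite [leLHS](_ : _ = (1 + k%:R * (rho - 1) / #|T|%:R) * potential u k x)//;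
  field.
Qed.

(** Markov's inequality for the potential: [2] comes from its initial value, [k (rho - 1)] from its
    growth over all balls, the power of [rho] from its value when [u] has load at least [l]. *)
Lemma Pr_load_le u r l k (D : nat) :
  (2 * r <= l)%N -> k = #|gball e u r| -> (0 < D)%N ->
  (forall v, (#|neighbours e v| < D)%N) -> 2 * D%:R <= rho -> (0 < #|T|)%N ->
  Pr (loads_after R e #|T|) (fun x => (l <= x u)%N)
    <= expR (2 + k%:R * (rho - 1)) * rho ^- (k * (l - 2 * r)).
Proof.
move=> rl kE D0 dD Drho T0.
have lb x : lipschitz x -> (l <= x u)%N%:R
    <= rho ^- (k * (l - 2 * r)) * potential u k x.
  move=> lx; have pot0 : 0 <= potential u k x.
    by apply: sumr_ge0 => A _; apply: prodr_ge0 => v _; exact: tilted_ge0.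
  case: leqP => [lu|_]; last by rewrite mulr_ge0 ?rhoV_ge0.
  rewrite mulrC ler_pdivlMr ?exprn_gt0// mul1r.
  (* Only the term indexed by the ball is kept; each of its factors is at least
     [rho ^+ (l - 2 * r)]. *)
  rewrite /potential (bigD1 (gball e u r)) ?kE//=.
  rewrite ler_wpDr//.
    by apply: sumr_ge0 => A _; apply: prodr_ge0 => v _; exact: tilted_ge0.
  rewrite mulnC exprM -prodr_const; apply: ler_prod => v vB.
  rewrite rhoX_ge0/=; have := lipschitz_gball lx vB => luv.
  apply: le_trans (_ : rho ^- r * rho ^+ (l - r) <= _).
    rewrite mulrC ler_pdivlMr ?exprn_gt0// -exprD.
    by apply: ler_weXn2l => //; lia.
  apply: ler_pM; rewrite ?rhoV_ge0 ?rhoX_ge0//; first exact: weight_gball.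
  by apply: ler_weXn2l => //; lia.
have q0 : 0 <= 1 + k%:R * (rho - 1) / #|T|%:R.
  by rewrite addr_ge0// divr_ge0// mulr_ge0// subr_ge0.
rewrite PrE Ex_loads_after.
have := @run_le_geometric R T e lipschitz _ _ _ q0
  (fun x v w => @lipschitz_add_ball x v w) _ lb #|T| [ffun=> 0%N] _.
move=> /(_ _ _)/le_trans; apply.
- by move=> x; rewrite mulrCA ExZ ler_wpM2l ?rhoV_ge0// Ex_allocate_potential.
- by move=> v w _; rewrite !ffunE.
rewrite mulrCA [leRHS]mulrC ler_wpM2l ?rhoV_ge0//.
rewrite [X in expR X]addrC expRD; apply: ler_pM.
- by rewrite exprn_ge0.
- by apply: sumr_ge0 => A _; apply: prodr_ge0 => v _; exact: tilted_ge0.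
- apply: le_trans (_ : expR (k%:R * (rho - 1) / #|T|%:R) ^+ #|T| <= _).
    by rewrite lerXn2r ?nnegrE ?expR_ge0// expR_ge1Dx.
  by rewrite -expRM_natr divfK// pnatr_eq0 -lt0n.
apply: le_trans (subset_products_le_expR _ _) _; first exact: tilted_ge0.
rewrite ler_expR (eq_bigr (weight u)) => [|v _].
  exact: sum_weight_le2 dD Drho.
by rewrite /tilted ffunE expr0 mulr1.
Qed.

End UpperBound.

Lemma Ex_loads_after_mono (R : realType) (T : finType) (e : rel T) m f g :
  (forall x, f x <= g x) ->
  Ex (loads_after R e m) f <= Ex (loads_after R e m) g.
Proof.
move=> fg; rewrite !Ex_loads_after.
elim: m [ffun=> 0%N] => [|m IH] x //=.
by apply: Ex_allocate_mono => v w _; exact: IH.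
Qed.

Lemma ln_natr_ge (R : realType) (c : R) :
  exists n0 : nat, forall n, (n0 <= n)%N -> (0 < n)%N /\ c <= ln n%:R.
Proof.
exists (Num.trunc (expR c)).+1 => n n0n.
have n0 : (0 < n)%N by exact: leq_trans n0n.
split=> //; rewrite -[c]expRK ler_ln ?posrE ?expR_gt0 ?ltr0n//.
apply/ltW/lt_le_trans; first exact: truncnS_gt.
by rewrite ler_nat.
Qed.

Lemma R1_ge (R : realType) (D c : nat) : (0 < D)%N ->
  exists n0 : nat, forall (T : finType) (e : rel T),
    (forall v, (#|neighbours e v| < D)%N) -> (n0 <= #|T|)%N -> (c <= R1 R e)%N.
Proof.
move=> D0; have [n0 hn0] := @ln_natr_ge R ((c * D ^ c * c)%:R + 1).
exists n0 => T e dD /hn0[T0 lnT].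
have [[r0 hr] _] := R1P R e; rewrite leqNgt; apply/negP => rc.
have /card_gt0P[u _] := T0.
have := le_trans lnT (hr u); apply/negP; rewrite -ltNge.
rewrite ltr_pwDr// !natrM; apply: ler_pM; rewrite ?mulr_ge0 ?ln_ge0 ?ler1n//.
  apply: ler_pM; rewrite // ler_nat ?(ltnW rc)//.
  apply: leq_trans (card_gball_le dD _ _) _; exact: leq_pexp2l (ltnW rc).
apply: le_trans (_ : (R1 R e)%:R <= _); last by rewrite ler_nat ltnW.
by apply/ltW/ln_sublinear; rewrite ltr0n.
Qed.

Lemma upper_tail (R : realType) (Delta : nat) (alpha : R) : 1 <= alpha ->
  exists n0 : nat, forall (T : finType) (e : rel T),
    symmetric e ->
    (forall v : T, (#|neighbours e v| <= Delta)%N) ->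
    (n0 <= #|T|)%N ->
    Pr (loads_after R e #|T|)
         (fun x => 56 * alpha * (R1 R e)%:R <= (max_load x)%:R)
      <= #|T|%:R `^ (- alpha).
Proof.
move=> a1; have [c hc] := @ln_natr_ge R 1.
(* [2 * Delta.+1] makes [rho = R1] large enough for [sum_weight_le2]; [c] gives [ln R1 >= 1]. *)
have [n0 hn0] := @R1_ge R Delta.+1 (2 * Delta.+1 + c) isT.
exists n0.+1 => T e se dD Tn; have T0 : (0 < #|T|)%N by exact: leq_trans Tn.
have := hn0 T e _ (ltnW Tn) => /(_ (fun v => dD v)).
have [[r0 hr] _] := R1P R e.
set r := R1 R e in r0 hr * => rc.
pose l := Num.trunc (56 * alpha * r%:R).
have rge0 : 0 <= r%:R :> R by [].
have lge0 : 0 <= 56 * alpha * r%:R by rewrite !mulr_ge0//; lra.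
have lle : l%:R <= 56 * alpha * r%:R by rewrite truncn_le.
have llt : 56 * alpha * r%:R < l%:R + 1 by rewrite natr1 truncnS_gt.
have r1 : 1 <= r%:R :> R by rewrite ler1n.
have lnr : 1 <= ln r%:R :> R by have [] := hc r; first lia.
have rl : (2 * r <= l)%N by rewrite truncn_ge_nat// natrM; nra.
apply: le_trans (_ : \sum_(u : T) #|T|%:R `^ (- alpha - 1) <= _); last first.
  have n1 : #|T|%:R != 0 :> R by rewrite pnatr_eq0 -lt0n.
  rewrite sumr_const powRB ?n1 ?implybT// powRr1// -[_ *+ _]mulr_natr.
  by rewrite divfK.
apply: le_trans (_ : \sum_(u : T)
    Pr (loads_after R e #|T|) (fun x => (l <= x u)%N) <= _).
  rewrite PrE; under eq_bigr do rewrite PrE.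
  rewrite -Ex_sum; apply: Ex_loads_after_mono => x.
  case: (lerP _ (max_load x)%:R) => [lx|_]; last first.
    by rewrite mulr0n; apply: sumr_ge0 => u _; exact: ler0n.
  have [u xu] := @bigop.eq_bigmax T (fun v => x v) T0.
  rewrite (bigD1 u)//= -xu -(ler_nat R) (le_trans lle lx) ler_wpDr//.
  by apply: sumr_ge0 => v _; exact: ler0n.
apply: ler_sum => u _.
apply: le_trans.
  apply: (@Pr_load_le R T e se r%:R r1 u r l _ Delta.+1 rl erefl) => //.
  by rewrite -natrM ler_nat; lia.
have := hr u; set k := #|gball e u r| => hk.
have k1 : 1 <= k%:R :> R by rewrite ler1n card_gball_gt0.
rewrite /powR pnatr_eq0 -[_ == _]negbK -lt0n T0 /=.
have -> : r%:R ^- (k * (l - 2 * r)) = expR (- ((k * (l - 2 * r))%:R * ln r%:R)) :> R.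
  by rewrite expRN expRM_natl lnK// posrE ltr0n.
rewrite -expRD ler_expR natrM natrB// natrM.
set Y := r%:R * k%:R * ln r%:R in hk.
have Y1 : r%:R * k%:R <= Y by rewrite ler_peMr// mulr_ge0.
have rk1 : 1 <= r%:R * k%:R :> R by nra.
have kr : k%:R <= r%:R * k%:R :> R by nra.
(* Truncation costs at most [1 <= alpha * r], which lowers 56 to 55. *)
have main : (55 * alpha - 2) * Y <= k%:R * (l%:R - 2 * r%:R) * ln r%:R.
  have Z0 : 0 <= k%:R * ln r%:R :> R by rewrite mulr_ge0//; lra.
  have : (55 * alpha - 2) * r%:R <= l%:R - 2 * r%:R by nra.
  by move=> /(ler_wpM2r Z0); rewrite /Y; congr (_ <= _); ring.
have : (alpha + 1) * ln #|T|%:R <= (alpha + 1) * Y by rewrite ler_wpM2l//; lra.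
(* As [2 + k (r - 1) <= 3 Y], the exponent is at most [- (55 alpha - 5) Y], and
   [55 alpha - 5 >= alpha + 1]. *)
nra.
Qed.

(** * Poissonization *)

Section TruncatedExponential.
Variable R : realType.

(** The exponential generating function of birth sequences with fewer than [a] births, all in a
    block of [b] vertices. *)
Definition trunc_exp (b : R) (a : nat) : {poly R} :=
  \poly_(c < a) (b ^+ c / c`!%:R).

Lemma deriv_trunc_exp b a : (trunc_exp b a)^`()%R = b *: trunc_exp b a.-1.
Proof.
apply/polyP => c; rewrite coef_deriv coefZ !coef_poly.
have -> : (c.+1 < a)%N = (c < a.-1)%N by lia.
case: ifP; rewrite ?mul0rn ?mulr0// => _.
have := fact_gt0 c; rewrite -(ltr0n R) => c0.
by rewrite factS natrM exprS -[LHS]mulr_natr; field; rewrite gt_eqF//= pnatr_eq0.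
Qed.

Lemma trunc_exp_coef_ge0 b a c : 0 <= b -> 0 <= (trunc_exp b a)`_c.
Proof.
by move=> b0; rewrite coef_poly; case: ifP => // _; rewrite divr_ge0// exprn_ge0.
Qed.

Lemma sum_exp_coeff_le_expR (b : R) a : 0 <= b ->
  \sum_(c < a) b ^+ c / c`!%:R <= expR b.
Proof.
move=> b0; rewrite (_ : \sum_(c < a) _ = series (exp_coeff b) a).
  apply: nondecreasing_cvgn_le; last exact: is_cvg_series_exp_coeff.
  apply/nondecreasing_seqP => m; rewrite -subr_ge0 seriesSB.
  by rewrite /exp_coeff /= divr_ge0// exprn_ge0.
by rewrite /series /= big_mkord.
Qed.

Lemma trunc_exp_horner1 b a : (trunc_exp b a).[1] = \sum_(c < a) b ^+ c / c`!%:R.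
Proof.
by rewrite horner_poly; apply: eq_bigr => c _; rewrite expr1n mulr1.
Qed.

Lemma trunc_exp_le_expR b a : 0 <= b -> (trunc_exp b a).[1] <= expR b.
Proof. by move=> b0; rewrite trunc_exp_horner1; exact: sum_exp_coeff_le_expR. Qed.

(** The sum omits the term of degree [a], which becomes a Poisson probability [t] on division by
    [expR b]; then [1 - t <= expR (- t)]. *)
Lemma trunc_exp_le b a : 0 <= b ->
  (trunc_exp b a).[1] <= expR (b - expR (- b) * b ^+ a / a`!%:R).
Proof.
move=> b0; rewrite trunc_exp_horner1.
have := sum_exp_coeff_le_expR a.+1 b0; rewrite big_ord_recr /= -lerBrDr.
move=> /le_trans; apply; set q := b ^+ a / _.
rewrite expRD (_ : expR b - q = expR b * (1 - expR (- b) * q)).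
  by rewrite ler_wpM2l ?expR_ge0// -mulrA; exact: expR_ge1Dx.
by rewrite mulrBr mulr1 mulrA expRxMexpNx_1 mul1r.
Qed.

Lemma coef_le_horner1 (p : {poly R}) m : (forall c, 0 <= p`_c) -> p`_m <= p.[1].
Proof.
move=> p0; case: (ltnP m (size p)) => mp; last first.
  rewrite nth_default// horner_coef; apply: sumr_ge0 => c _.
  by rewrite expr1n mulr1.
rewrite horner_coef (bigD1 (Ordinal mp))//= expr1n mulr1 ler_wpDr//.
by apply: sumr_ge0 => c _; rewrite expr1n mulr1.
Qed.

Variable I : finType.

Definition trunc_exps (b : I -> R) (a : I -> nat) : {poly R} :=
  \prod_i trunc_exp (b i) (a i).

(** Thresholds left after a birth in block [i]. A threshold 0 stays 0, in accordance with
    [trunc_exp b 0 = 0]. *)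
Definition decr (a : I -> nat) (i : I) : I -> nat :=
  fun j => if j == i then (a j).-1 else a j.

Lemma deriv_trunc_exps b a :
  (trunc_exps b a)^`()%R = \sum_i b i *: trunc_exps b (decr a i).
Proof.
suff H r : uniq r -> (\prod_(j <- r) trunc_exp (b j) (a j))^`()%R
    = \sum_(i <- r) b i *: \prod_(j <- r) trunc_exp (b j) (decr a i j).
  by apply: H; exact: index_enum_uniq.
elim: r => [|i r IH] /=; first by rewrite !big_nil derivC.
move=> /andP[ir ur]; rewrite !big_cons derivM IH// deriv_trunc_exp; congr (_ + _).
  rewrite /decr eqxx -scalerAl; congr (_ *: (_ * _)).
  by apply: eq_big_seq => j jr; case: eqVneq => // ji; rewrite -ji jr in ir.
rewrite mulr_sumr; apply: eq_big_seq => k kr; rewrite big_cons -scalerAr.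
by rewrite {2}/decr; case: eqVneq => // ki; rewrite ki kr in ir.
Qed.

Lemma trunc_exps_coef_ge0 b a c : (forall i, 0 <= b i) -> 0 <= (trunc_exps b a)`_c.
Proof.
move=> b0; rewrite /trunc_exps; elim/big_rec: _ c => [|i p _ IH] c.
  by rewrite coef1.
by rewrite coefM; apply: sumr_ge0 => j _; rewrite mulr_ge0 ?trunc_exp_coef_ge0.
Qed.

Lemma trunc_exps_coef0 b a : (forall i, 0 < a i)%N -> (trunc_exps b a)`_0 = 1.
Proof.
move=> a0; rewrite -horner_coef0 horner_prod big1// => i _.
by rewrite horner_coef0 coef_poly a0 expr0 divr1.
Qed.

(* The probability that [m] uniform births among [n] vertices put fewer than
   [a i] in each block [i] of size [b i]. *)
Definition few_births (n : nat) (b : I -> R) (m : nat) (a : I -> nat) : R :=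
  m`!%:R / n%:R ^+ m * (trunc_exps b a)`_m.

(** Conditioning on the block of the first birth amounts to differentiating the generating
    polynomial. *)
Lemma few_birthsS n b m a : (0 < n)%N ->
  few_births n b m.+1 a = (\sum_i b i * few_births n b m (decr a i)) / n%:R.
Proof.
move=> n0; have := coef_deriv (trunc_exps b a) m.
rewrite deriv_trunc_exps coef_sum => E.
rewrite /few_births factS mulnC natrM -[_ * m.+1%:R]mulr1.
have nn : (n%:R : R) != 0 by rewrite pnatr_eq0 -lt0n.
have -> : \sum_i b i * (m`!%:R / n%:R ^+ m * (trunc_exps b (decr a i))`_m)
    = m`!%:R / n%:R ^+ m * ((trunc_exps b a)`_m.+1 * m.+1%:R).
  rewrite mulr_natr -E mulr_sumr; apply: eq_bigr => i _.
  by rewrite coefZ; ring.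
by rewrite exprS; field; rewrite nn expf_neq0.
Qed.

Lemma few_births_ge0 n b m a : (forall i, 0 <= b i) -> 0 <= few_births n b m a.
Proof.
by move=> b0; rewrite mulr_ge0 ?trunc_exps_coef_ge0// divr_ge0// exprn_ge0.
Qed.

Lemma few_births0 n b a : (forall i, 0 < a i)%N -> few_births n b 0 a = 1.
Proof. by move=> a0; rewrite /few_births trunc_exps_coef0// expr0 divr1 mulr1. Qed.

(** A weak Stirling bound: the price of passing to independent Poisson variables. *)
Lemma fact_expR_le n : (0 < n)%N ->
  n`!%:R / n%:R ^+ n * expR n%:R <= expR 1 * n%:R :> R.
Proof.
case: n => // n _; elim: n => [|n IH].
  by rewrite expr1 divr1 mul1r mulr1.
have N0 : 0 < n.+1%:R :> R by rewrite ltr0n.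
have M0 : 0 < n.+2%:R :> R by rewrite ltr0n.
have e2 : n.+2%:R = n.+1%:R + 1 :> R by rewrite natr1.
have key : expR 1 * (n.+1%:R / n.+2%:R) ^+ n.+2 <= 1 :> R.
  rewrite -[leRHS](expRxMexpNx_1 1) ler_wpM2l ?expR_ge0//.
  have -> : - 1 = (- n.+2%:R^-1) * n.+2%:R :> R by rewrite mulNr mulVf// gt_eqF.
  rewrite expRM_natr; apply: lerXn2r; rewrite ?nnegrE ?expR_ge0 ?divr_ge0//.
  rewrite (_ : n.+1%:R / n.+2%:R = 1 - n.+2%:R^-1); first exact: expR_ge1Dx.
  by rewrite -[n.+1%:R](addrK 1) -e2 mulrBl divff ?gt_eqF// mul1r.
have -> : n.+2`!%:R / n.+2%:R ^+ n.+2 * expR n.+2%:R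
    = (n.+1`!%:R / n.+1%:R ^+ n.+1 * expR n.+1%:R) *
      (expR 1 * (n.+1%:R / n.+2%:R) ^+ n.+2) * (n.+2%:R / n.+1%:R) :> R.
  rewrite {2}e2 expRD factS natrM expr_div_n (exprS n.+1%:R n.+1).
  by field; rewrite !expf_neq0 ?gt_eqF.
apply: le_trans (_ : expR 1 * n.+1%:R * 1 * (n.+2%:R / n.+1%:R) <= _); last first.
  by rewrite mulr1 mulrA mulrAC mulfK// gt_eqF.
rewrite ler_wpM2r ?divr_ge0//; apply: ler_pM => //.
Qed.

(* Poissonization: a coefficient of a polynomial with nonnegative coefficients is
   at most its value at 1, which here factors over the blocks as if the births
   in them were independent Poisson variables. *)
Lemma few_births_le n (b : I -> R) (C : pred I) (k a : I -> nat) : (0 < n)%N ->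
  (forall i, 0 <= b i) -> \sum_i b i = n%:R -> (forall i, C i -> a i = k i) ->
  few_births n b n a <= expR 1 * n%:R *
    expR (- \sum_(i | C i) expR (- b i) * b i ^+ k i / (k i)`!%:R).
Proof.
move=> n0 b0 sb ak.
apply: le_trans (_ : n`!%:R / n%:R ^+ n * (trunc_exps b a).[1] <= _).
  rewrite ler_wpM2l ?divr_ge0 ?exprn_ge0//; apply: coef_le_horner1 => c.
  exact: trunc_exps_coef_ge0.
set p := fun i => expR (- b i) * b i ^+ k i / (k i)`!%:R.
apply: le_trans (_ : n`!%:R / n%:R ^+ n *
    expR (\sum_i (b i - (if C i then p i else 0))) <= _).
  rewrite ler_wpM2l ?divr_ge0 ?exprn_ge0// horner_prod expR_sum.
  apply: ler_prod => i _; apply/andP; split.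
    rewrite trunc_exp_horner1; apply: sumr_ge0 => c _.
    by rewrite divr_ge0// exprn_ge0.
  case: ifP => Ci; first by rewrite (ak _ Ci); exact: trunc_exp_le.
  by rewrite subr0; exact: trunc_exp_le_expR.
rewrite sumrB sb -big_mkcond /= expRD mulrA ler_wpM2r ?expR_ge0//.
exact: fact_expR_le.
Qed.

End TruncatedExponential.

(** * From loads to births in disjoint blocks *)

Section FewBirths.
Variables (R : realType) (T : finType) (e : rel T) (l : nat).
Variables (I : finType) (blk : T -> I) (C : pred I) (Q : I -> {set T}).
Variable k : I -> nat.
Hypothesis kQ : forall i, C i -> (#|Q i| * l < k i)%N.
Hypothesis blkQ :
  forall v w, C (blk v) -> w \in gball e v l -> w \in Q (blk v).

Let low (x : loads T) : bool := [forall v, (x v <= l)%N].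
Let b (i : I) : R := #|[set v | blk v == i]|%:R.

Let sum_b (f : I -> R) : \sum_i b i * f i = \sum_v f (blk v).
Proof.
rewrite [RHS](partition_big blk predT)//=; apply: eq_bigr => i _.
rewrite (eq_bigr (fun=> f i)) => [|v /eqP->//]; rewrite sumr_const mulr_natl.
by congr (_ *+ _); apply: eq_card => v; rewrite !inE.
Qed.

Let run_high s x : ~~ low x -> run e s x (fun y => (low y)%:R : R) <= 0.
Proof.
elim: s x => [|s IH] x /= xl; first by rewrite (negPf xl).
apply: le_trans (@Ex_allocate_le R T e x _ (fun=> 0) _) _.
  move=> v w _; apply: IH; move: xl => /forallPn[z xz].
  by apply/forallPn; exists z; rewrite ffunE -ltnNge ltn_addr// ltnNge.
by rewrite big1// mul0r.
Qed.

(** For [C i], another [a i] births in block [i] would bring the load of [Q i] to [k i], hence some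
    load above [l]. While all loads are at most [l], a ball born in the block stops in [Q i], so
    [a i] drops by one as the load of [Q i] rises by one. *)
Let run_low s (x : loads T) a : (0 < #|T|)%N ->
  (forall i, C i -> (k i <= a i + \sum_(v in Q i) x v)%N) ->
  (forall i, ~~ C i -> (s < a i)%N) ->
  run e s x (fun y => (low y)%:R : R) <= few_births #|T| b s a.
Proof.
move=> T0; have b0 i : 0 <= b i by rewrite /b.
elim: s x a => [|s IH] x a Ca Na.
  have [xl|xl] := boolP (low x); last first.
    by apply: le_trans (run_high 0 xl) _; exact: few_births_ge0.
  rewrite few_births0 /= ?lern1 ?leq_b1// => i.
  have [Ci|] := boolP (C i); last exact: Na.
  have := leq_trans (kQ Ci) (Ca i Ci).
  have : (\sum_(v in Q i) x v <= #|Q i| * l)%N.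
    by rewrite -sum_nat_const; apply: leq_sum => v _; exact: (forallP xl).
  lia.
have [xl|xl] := boolP (low x); last first.
  by apply: le_trans (run_high s.+1 xl) _; exact: few_births_ge0.
rewrite /= few_birthsS// sum_b.
apply: (@Ex_allocate_le R T e x _
  (fun v => few_births #|T| b s (decr a (blk v)))) => v w vw.
apply: IH => i.
  move=> Ci; have := Ca i Ci; rewrite /decr.
  have -> : (\sum_(v0 in Q i) add_ball x w v0 =
      \sum_(v0 in Q i) x v0 + (w \in Q i))%N.
    under eq_bigr do rewrite ffunE.
    by rewrite big_split /= sum_eq_mem.
  case: eqVneq => [ib|_]; last by lia.
  have -> : w \in Q i by rewrite ib blkQ -?ib//;
    apply: (fintype.subsetP (gballS e v (forallP xl v))); exact: stops_gball.
  by lia.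
by move=> Ci; have := Na i Ci; rewrite /decr; case: ifP; lia.
Qed.

Lemma Pr_low_le : (0 < #|T|)%N ->
  Pr (loads_after R e #|T|) (fun x => max_load x <= l)%N
    <= expR 1 * #|T|%:R *
       expR (- \sum_(i | C i) expR (- b i) * b i ^+ k i / (k i)`!%:R).
Proof.
move=> T0; rewrite PrE Ex_loads_after.
(* Outside [C], [n] births cannot reach the threshold [n + 1]. *)
pose a i := if C i then k i else #|T|.+1.
have -> : (fun x : loads T => (max_load x <= l)%N%:R : R) = (fun x => (low x)%:R).
  apply/funext => x; congr (nat_of_bool _)%:R.
  apply/bigmax_leqP/forallP => // H v; exact: H.
apply: le_trans (@run_low #|T| _ a T0 _ _) _.
- by move=> i Ci; rewrite /a Ci leq_addr.
- by move=> i Ci; rewrite /a (negPf Ci).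
apply: few_births_le => //.
- under eq_bigr do rewrite -[b _]mulr1.
  by rewrite (sum_b (fun=> 1)) sumr_const.
- by move=> i Ci; rewrite /a Ci.
Qed.

End FewBirths.

(** * Lower tail *)

(** In a maximal subset of [S] with pairwise distances above [2 r], the [r]-balls are disjoint, and
    by maximality the [2 r]-balls cover [S]. *)
Lemma exists_packing (T : finType) (e : rel T) (S : {set T}) (D r : nat) :
  symmetric e -> (forall v, (#|neighbours e v| < D)%N) ->
  exists S' : {set T}, [/\ S' \subset S, (#|S| <= #|S'| * D ^ (2 * r))%N &
    forall u u' v, u \in S' -> u' \in S' ->
      v \in gball e u r -> v \in gball e u' r -> u = u'].
Proof.
move=> se dD.
pose sep u u' := (u' \in gball e u (2 * r)) ==> (u == u').
pose P (A : {set T}) := (A \subset S) && [forall u in A, forall u' in A, sep u u'].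
have [|A /maxsetP[/andP[AS sepA] Amax]] := @ex_maxset T P.
  exists finset.set0; rewrite /P finset.sub0set.
  by apply/forall_inP => u; rewrite finset.in_set0.
have {}sepA u u' : u \in A -> u' \in A -> u' \in gball e u (2 * r) -> u = u'.
  move=> uA u'A uu'; move/forall_inP/(_ u uA)/forall_inP/(_ u' u'A): sepA.
  by rewrite /sep uu' => /eqP.
exists A; split=> //; last first.
  move=> u u' v uA u'A uv u'v; apply: sepA => //.
  by rewrite mul2n -addnn; apply: gball_trans uv _; exact: gball_sym.
have sub : S \subset \bigcup_(u in A) gball e u (2 * r).
  apply/fintype.subsetP => w wS; apply/finset.bigcupP/exists_inP.
  apply: contraT => /exists_inPn far.
  have wA : w \notin A by apply/negP => wA; have := far w wA; rewrite gball_center.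
  suff PwA : P (w |: A).
    by move: wA; rewrite -(Amax _ PwA (finset.subsetUr _ _)) setU11.
  apply/andP; split; first by rewrite finset.subUset finset.sub1set wS.
  apply/forall_inP => u /finset.setU1P uw; apply/forall_inP => u' /finset.setU1P u'w.
  apply/implyP => uu'; apply/eqP; case: uw => [uw|uA]; case: u'w => [u'w|u'A].
  - by rewrite uw u'w.
  - by have := far u' u'A; rewrite -uw gball_sym.
  - by have := far u uA; rewrite -u'w uu'.
  - exact: sepA.
apply: leq_trans (subset_leq_card sub) _.
have bnd : (#|\bigcup_(u in A) gball e u (2 * r)| <= \sum_(u in A) D ^ (2 * r))%N.
  elim/big_rec2: _ => [|v m B _ IHv]; first by rewrite cards0.
  apply: leq_trans (leq_card_setU _ _) _; apply: leq_add => //.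
  exact: card_gball_le.
by rewrite sum_nat_const in bnd.
Qed.

(** At the fixed radius [c.+1] bounded degrees bound the size weight, so for large [n] the whole
    vertex set is an admissible [S]. *)
Lemma R1g_ge (R : realType) (D c : nat) (gamma : R) : (0 < D)%N ->
  0 < gamma <= 2^-1 ->
  exists n0 : nat, forall (T : finType) (e : rel T),
    (forall v, (#|neighbours e v| < D)%N) -> (n0 <= #|T|)%N ->
    (c <= R1g e gamma)%N.
Proof.
move=> D0 hg; have /andP[g0 g1] := hg.
have [n0 hn0] := @ln_natr_ge R ((c.+1 * D ^ c.+1 * c.+1)%:R + 1).
exists (maxn n0 2) => T e dD; rewrite geq_max => /andP[/hn0[T0 lnT] T1].
have [_ rmax] := R1gP e hg T1.
apply: leq_trans (leqnSn c) (rmax _ _); split=> //.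
exists [set: T]; split.
  rewrite cardsT -[leRHS]powRr1 ?ler0n//; apply: ler_powR; rewrite ?ler1n//.
  by rewrite [leRHS](splitr 1) mul1r lerD2l.
move=> u _; apply: lt_le_trans lnT; rewrite ltr_pwDr// !natrM.
apply: ler_pM; rewrite ?mulr_ge0 ?ln_ge0 ?ler1n//.
  by apply: ler_pM; rewrite // ler_nat card_gball_le.
by apply/ltW/ln_sublinear; rewrite ltr0n.
Qed.

(** This rests on [k! <= k ^ k <= (b M) ^ k]. *)
Lemma poisson_ge (R : realType) (b k M : nat) : (k <= b * M)%N -> (0 < M)%N ->
  expR (- (b%:R + k%:R * ln M%:R)) <= expR (- b%:R) * b%:R ^+ k / k`!%:R :> R.
Proof.
move=> kbM M0; rewrite opprD expRD -mulrA ler_wpM2l ?expR_ge0//.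
rewrite expRN expRM_natl lnK ?posrE ?ltr0n//.
rewrite ler_pdivlMr ?ltr0n ?fact_gt0// mulrC ler_pdivrMr ?exprn_gt0 ?ltr0n//.
rewrite -exprMn -natrM -natrX ler_nat.
apply: leq_trans (_ : k ^ k <= _)%N; last first.
  by case: k kbM => // k kbM; rewrite leq_exp2r.
elim: k {kbM} => // k IH; rewrite factS expnS leq_mul2l /=.
by apply: leq_trans IH _; case: k => // k; rewrite leq_exp2r.
Qed.

(** * Poisson probability of overfilling a target *)

Section PoissonBlocks.
Variables (R : realType) (gamma Lam : R) (beta l r : nat).
Hypothesis g0 : 0 < gamma.
Hypothesis g1 : gamma <= 2^-1.
Hypothesis beta0 : (0 < beta)%N.
Hypothesis ll : l%:R <= gamma * r%:R / 4.
Hypothesis gr : 8 <= gamma * r%:R.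
Hypothesis lnr : 1 <= ln r%:R :> R.
Hypothesis YL : r%:R * beta%:R * ln r%:R <= Lam.

Let Y := r%:R * beta%:R * ln r%:R : R.

Let b1 : 1 <= beta%:R :> R. Proof. by rewrite ler1n. Qed.

Let r16 : 16 <= r%:R :> R.
Proof.
have : gamma * r%:R <= 2^-1 * r%:R by rewrite ler_wpM2r.
by move: gr; lra.
Qed.

Let gY : gamma * Y <= gamma * Lam. Proof. by rewrite ler_wpM2l// ltW. Qed.

Let gYr : 8 * ln r%:R <= gamma * Y.
Proof.
apply: le_trans (_ : gamma * (r%:R * ln r%:R) <= _).
  by rewrite mulrA ler_wpM2r//; move: lnr; lra.
rewrite ler_wpM2l ?(ltW g0)// /Y mulrAC ler_peMr// mulr_ge0//; move: lnr; lra.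
Qed.

Let gYb : 8 * beta%:R <= gamma * Y.
Proof.
apply: le_trans (_ : gamma * (r%:R * beta%:R) <= _).
  by rewrite mulrA ler_wpM2r.
by rewrite ler_wpM2l ?(ltW g0)// ler_peMr// mulr_ge0.
Qed.

Let lr : (8 * l <= r)%N.
Proof.
rewrite -(ler_nat R) natrM.
have : gamma * r%:R <= 2^-1 * r%:R by rewrite ler_wpM2r.
by move: ll; lra.
Qed.

(** Here [beta] is the size of the [r]-ball, [b] that of the half-radius ball and [Lam] is [ln n].
    With [M = r ^ 2] in [poisson_ge], the exponent [b + 2 (beta l + 1) ln r] is at most
    [7/8 gamma Y]. *)
Lemma poisson_ge_slow (b : nat) : (0 < b)%N -> (b <= beta)%N ->
  (beta <= r * b)%N ->
  expR (- (gamma * Lam)) <=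
    expR (- b%:R) * b%:R ^+ (beta * l).+1 / (beta * l).+1`!%:R.
Proof.
move=> b0 bb brb.
have r0 : (16 <= r)%N by rewrite -(ler_nat R).
apply: le_trans (@poisson_ge R b (beta * l).+1 (r ^ 2) _ _); last 2 first.
- have : (beta * l.+1 <= r * b * r)%N by apply: leq_mul => //; lia.
  by rewrite mulnS -mulnn; lia.
- by rewrite expn_gt0; lia.
rewrite ler_expR lerN2 natrX lnXn ?ltr0n; last by lia.
rewrite -natr1 natrM -[ln _ *+ 2]mulr_natr.
have bbR : b%:R <= beta%:R :> R by rewrite ler_nat.
have lY : beta%:R * l%:R * ln r%:R <= gamma / 4 * Y.
  rewrite /Y [leRHS](_ : _ = beta%:R * (gamma * r%:R / 4) * ln r%:R); last by ring.
  by rewrite ler_wpM2r ?ler_wpM2l//; move: lnr; lra.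
rewrite (_ : _ * (ln r%:R * 2) = 2 * (beta%:R * l%:R * ln r%:R) + 2 * ln r%:R);
  last by ring.
by move: gY gYr gYb b1; lra.
Qed.

(** Births at a single vertex have mean 1. From [k <= 2 beta] and
    [ln k <= (r + 1) ln D <= gamma r ln r / 4] follows [k ln k <= gamma Y / 2]. *)
Lemma poisson_ge_fast (b D : nat) : (1 < D)%N -> (r * b < beta)%N ->
  (beta <= D ^ r)%N -> 8 * ln D%:R <= gamma * ln r%:R ->
  expR (- (gamma * Lam)) <=
    expR (- 1%:R) * 1%:R ^+ (b * l).+1 / (b * l).+1`!%:R.
Proof.
move=> D1 rb betaD lnD.
set k := (b * l).+1.
have kD : (k <= D ^ r.+1)%N.
  apply: leq_trans (_ : beta <= _)%N.
    apply: leq_ltn_trans rb; rewrite mulnC; apply: leq_mul => //; move: lr; lia.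
  by apply: leq_trans betaD _; rewrite leq_exp2l.
apply: le_trans (_ : expR (- (1%:R + k%:R * ln k%:R)) <= _); last first.
  by apply: (@poisson_ge R 1 k k); rewrite // mul1n.
rewrite ler_expR lerN2.
have D0 : 0 < D%:R :> R by rewrite ltr0n ltnW.
have lnk : ln k%:R <= r.+1%:R * ln D%:R :> R.
  rewrite -ler_expR expRM_natl !lnK ?posrE ?ltr0n//; last exact: ltnW.
  by rewrite -natrX ler_nat.
have lnD0 : 0 <= ln D%:R :> R by rewrite ln_ge0// ler1n ltnW.
have kb : k%:R <= gamma / 4 * beta%:R + 1.
  rewrite /k -natr1 lerD2r natrM.
  apply: le_trans (_ : b%:R * (gamma * r%:R / 4) <= _); first by rewrite ler_wpM2l.
  rewrite (_ : _ * (_ / 4) = gamma / 4 * (r%:R * b%:R)); last by ring.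
  by rewrite ler_wpM2l ?divr_ge0 ?(ltW g0)// -natrM ler_nat ltnW.
have lnk2 : ln k%:R <= gamma / 4 * (r%:R * ln r%:R).
  apply: le_trans lnk _; apply: le_trans (_ : r%:R * 2 * ln D%:R <= _).
    by rewrite ler_wpM2r// -natr1; move: r16; lra.
  rewrite (_ : gamma / 4 * _ = r%:R * (gamma * ln r%:R / 4)); last by ring.
  by rewrite -mulrA ler_wpM2l//; lra.
have lnk0 : 0 <= ln k%:R :> R by rewrite ln_ge0// ler1n.
have kln : k%:R * ln k%:R <= beta%:R * 2 * (gamma / 4 * (r%:R * ln r%:R)).
  apply: ler_pM => //; apply: le_trans kb _.
  have : gamma * beta%:R <= 2^-1 * beta%:R by rewrite ler_wpM2r.
  by move: b1; lra.
rewrite (_ : beta%:R * 2 * _ = gamma * Y / 2) in kln; last by rewrite /Y; field.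
by move: gY gYb b1; lra.
Qed.

End PoissonBlocks.

(** * Choice of the two radii *)

Section Blocks.
Variables (R : realType) (T : finType) (e : rel T) (D r l : nat).
Hypothesis lr : (8 * l <= r)%N.

(* If [gball u r] is at most [r] times larger than [gball u (r / 2)], the births in
   the latter suffice to fill the former; otherwise births at [u] alone suffice to
   fill [gball u (r / 2)], which is then small enough. *)
Let grows u : bool := (#|gball e u r| <= r * #|gball e u (r %/ 2)|)%N.

Definition source (u : T) : {set T} :=
  if grows u then gball e u (r %/ 2) else [set u].

Definition target (u : T) : {set T} :=
  if grows u then gball e u r else gball e u (r %/ 2).

Lemma source_sub u : source u \subset gball e u r.
Proof.
rewrite /source; case: ifP => _; first by apply: gballS; exact: leq_div.
by rewrite finset.sub1set gball_center.
Qed.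

(** As [8 l <= r], there is room for [l] moves: [r / 2 + l <= r] in one case, [l <= r / 2] in the
    other. *)
Lemma source_target u v w :
  v \in source u -> w \in gball e v l -> w \in target u.
Proof.
rewrite /source /target; case: ifP => _ vu wv.
  apply: (fintype.subsetP (gballS e u (_ : r %/ 2 + l <= r)%N)); first by lia.
  exact: gball_trans vu wv.
move: vu; rewrite finset.in_set1 => /eqP uv; rewrite uv in wv.
by apply: (fintype.subsetP (gballS e u (_ : l <= r %/ 2)%N)) wv; lia.
Qed.

Lemma source_poisson_ge u (gamma Lam : R) :
  (forall v, (#|neighbours e v| < D)%N) -> (1 < D)%N ->
  0 < gamma <= 2^-1 -> l%:R <= gamma * r%:R / 4 ->
  8 <= gamma * r%:R -> 1 <= ln r%:R :> R -> 8 * ln D%:R <= gamma * ln r%:R ->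
  r%:R * #|gball e u r|%:R * ln r%:R <= Lam ->
  expR (- (gamma * Lam)) <= expR (- #|source u|%:R) *
    #|source u|%:R ^+ (#|target u| * l).+1 / (#|target u| * l).+1`!%:R.
Proof.
move=> dD D1 /andP[g0 g1] ll gr lnr lnD YL.
have beta0 := card_gball_gt0 e u r.
rewrite /source /target; case: ifP => [gu|/negbT gu].
  apply: poisson_ge_slow ll gr lnr YL _ _ _ _ => //; first exact: card_gball_gt0.
  by apply: subset_leq_card; apply: gballS; lia.
rewrite cards1; apply: poisson_ge_fast ll gr lnr YL _ _ D1 _ _ lnD => //.
  by rewrite ltnNge.
exact: card_gball_le.
Qed.

End Blocks.

Lemma lower_tail (R : realType) (Delta : nat) (gamma A : R) :
  0 < gamma <= 2^-1 -> 0 < A ->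
  exists n0 : nat, forall (T : finType) (e : rel T),
    symmetric e ->
    (forall v : T, (#|neighbours e v| <= Delta)%N) ->
    (n0 <= #|T|)%N ->
    Pr (loads_after R e #|T|)
       (fun x => (max_load x)%:R < gamma * (R1g e gamma)%:R / 4)
      <= #|T|%:R `^ (- A).
Proof.
move=> hg A0; have /andP[g0 g1] := hg; pose D := Delta.+2.
(* [c1] gives [ln r >= 1] and [8 ln D <= gamma ln r]; [c2] gives [gamma r >= 8]. *)
have [c1 hc1] := @ln_natr_ge R (8 * ln D%:R / gamma + 1).
have [c2 hc2] : exists c2 : nat, 8 / gamma <= c2%:R.
  by exists (Num.trunc (8 / gamma)).+1; apply/ltW/truncnS_gt.
have [n1 hn1] := @R1g_ge R D (c1 + c2) gamma isT hg.
(* Chosen so that [expR (Lam / 4) >= 1 + Lam ^ 2 / 32] is at least [1 + Lam + A Lam] in the end. *)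
have [n2 hn2] := @ln_natr_ge R (64 * (A + 2)).
exists (maxn n1 (maxn n2 2)) => T e se dD'; rewrite !geq_max.
have dD v : (#|neighbours e v| < D)%N by rewrite ltnS ltnW// ltnS.
move=> /and3P[/(hn1 _ _ dD) rc /hn2[T0 LamA] T1].
have [[r0 [S [cardS Sr]]] _] := R1gP e hg T1.
set r := R1g e gamma in rc r0 Sr *; set Lam := ln #|T|%:R in LamA Sr.
have [_ lnr0] := hc1 r (leq_trans (leq_addr _ _) rc).
have lnD0 : 0 <= ln D%:R :> R by rewrite ln_ge0// ler1n.
have lnr : 1 <= ln r%:R :> R.
  apply: le_trans lnr0; rewrite lerDr divr_ge0 ?mulr_ge0//; exact: ltW.
have lnD : 8 * ln D%:R <= gamma * ln r%:R.
  by rewrite -ler_pdivrMl// mulrC; lra.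
have gr : 8 <= gamma * r%:R.
  rewrite -ler_pdivrMl// mulrC; apply: le_trans hc2 _.
  by rewrite ler_nat (leq_trans (leq_addl _ _) rc).
pose l := Num.trunc (gamma * r%:R / 4).
have gr0 : 0 <= gamma * r%:R / 4 by lra.
have ll : l%:R <= gamma * r%:R / 4 by rewrite truncn_le.
have lr : (8 * l <= r)%N.
  rewrite -(ler_nat R) natrM.
  have : gamma * r%:R <= 2^-1 * r%:R by rewrite ler_wpM2r.
  by lra.
have nE (z : R) : #|T|%:R `^ z = expR (z * Lam).
  by rewrite /powR pnatr_eq0 -[_ == _]negbK -lt0n T0.
have rL : r%:R * ln r%:R <= Lam.
  have /card_gt0P[u uS] : (0 < #|S|)%N.
    by rewrite -(ltr0n R); apply: lt_le_trans cardS; rewrite nE expR_gt0.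
  apply: le_trans (ltW (Sr u uS)); rewrite ler_wpM2r//; first by lra.
  by rewrite ler_peMr// ler1n card_gball_gt0.
have [S' [S'S cardS' S'sep]] := exists_packing S r se dD.
(* [None] is the block of the vertices that lie in no source. *)
pose C : pred (option T) := mem [set Some u | u in S'].
pose blk v := [pick u in S' | v \in source e r u].
pose Q (i : option T) := if i is Some u then target e r u else finset.set0.
pose k (i : option T) := (#|Q i| * l).+1.
have CSome i : C i -> exists2 u, u \in S' & i = Some u.
  by move=> /imsetP.
have blkE u v : u \in S' -> (blk v == Some u) = (v \in source e r u).
  move=> uS'; rewrite /blk; case: pickP => [u' /andP[u'S' vu']|none].
    apply/eqP/idP => [[<-//]|vu]; congr Some.
    by apply: (S'sep _ _ v) => //; exact: (fintype.subsetP (source_sub _ _ _)).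
  by have := none u; rewrite uS' /= => ->.
have hkQ i : C i -> (#|Q i| * l < k i)%N by [].
have hblkQ v w : C (blk v) -> w \in gball e v l -> w \in Q (blk v).
  move=> /CSome[u uS' bu] wv; rewrite bu /=; apply: (source_target lr _ wv).
  by rewrite -blkE// bu.
have := @Pr_low_le R T e l _ blk C Q k hkQ hblkQ T0.
set s := \sum_(i | C i) _ => bound.
(* Since [D ^ (2 r) <= n ^ (1/4)], the packing has at least [n ^ (1/4 + gamma)] points, each
   contributing at least [n ^ (- gamma)]. *)
have s_ge : expR (Lam / 4) <= s.
  apply: le_trans (_ : #|S'|%:R * expR (- (gamma * Lam)) <= _); last first.
    have SomeI : injective (@Some T) by move=> u u' [].
    rewrite mulr_natl -(card_imset _ SomeI) -sumr_const.
    apply: ler_sum => i /CSome[u uS' ->].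
    have -> : #|[set v | blk v == Some u]| = #|source e r u|.
      by apply: eq_card => v; rewrite !inE blkE.
    apply: source_poisson_ge (dD) isT hg ll gr lnr lnD _ => //.
    by apply/ltW/Sr; exact: (fintype.subsetP S'S).
  have D2r : (D ^ (2 * r))%:R <= expR (Lam / 4) :> R.
    rewrite natrX -[D%:R in leLHS]lnK ?posrE ?ltr0n// -expRM_natl ler_expR natrM.
    have : r%:R * (8 * ln D%:R) <= r%:R * (gamma * ln r%:R) by rewrite ler_wpM2l.
    rewrite mulrCA (mulrCA _ gamma) => rD.
    have : gamma * (r%:R * ln r%:R) <= 2^-1 * Lam.
      by apply: ler_pM => //; [exact: ltW|rewrite mulr_ge0//; lra].
    by rewrite -mulrA; lra.
  have : expR ((2^-1 + gamma) * Lam) <= #|S'|%:R * expR (Lam / 4).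
    rewrite -nE; apply: le_trans cardS _.
    apply: le_trans (_ : #|S'|%:R * (D ^ (2 * r))%:R <= _).
      by rewrite -natrM ler_nat.
    by rewrite ler_wpM2l.
  rewrite -ler_pdivrMr ?expR_gt0// -expRN -expRD => cS'.
  apply: le_trans (_ : expR ((2^-1 + gamma) * Lam - Lam / 4) *
    expR (- (gamma * Lam)) <= _); last by rewrite ler_wpM2r ?expR_ge0//; exact: cS'.
  by rewrite -expRD ler_expR (_ : _ - _ - _ = Lam / 4)//; field.
apply: le_trans (_ : Pr (loads_after R e #|T|) (fun x => max_load x <= l)%N <= _).
  rewrite !PrE; apply: Ex_loads_after_mono => x.
  case: ltrP => [xl|_] //; rewrite truncn_ge_nat// (ltW xl)//.
apply: le_trans bound _; rewrite nE -[X in _ * X * _](lnK) ?posrE ?ltr0n//.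
rewrite -!expRD ler_expR -/Lam.
have L0 : 0 <= Lam / 4 by lra.
have := expR_ge1Dxn 1 L0; rewrite (_ : 2`!%:R = 2)//.
have : 64 * (A + 2) * Lam <= Lam * Lam by rewrite ler_wpM2r//; lra.
rewrite exprMn !expr2 => LL exL.
suff : 1 + Lam + A * Lam <= s by lra.
apply: le_trans s_ge; apply: le_trans exL.
by nra.
Qed.

Theorem theorem4p1 (R : realType) (Delta : nat) (gamma alpha A : R)
    (hgamma : 0 < gamma <= 2^-1) (halpha : 1 <= alpha) (hA : 0 < A) :
  exists n0 : nat, forall (T : finType) (e : rel T),
    symmetric e -> irreflexive e ->
    (forall v : T, (#|neighbours e v| <= Delta)%N) ->
    (n0 <= #|T|)%N ->
    Pr (loads_after R e #|T|)
       (fun x => (max_load x)%:R < gamma * (R1g e gamma)%:R / 4)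
      <= #|T|%:R `^ (- A)
    /\ Pr (loads_after R e #|T|)
         (fun x => 56 * alpha * (R1 R e)%:R <= (max_load x)%:R)
      <= 5 * #|T|%:R `^ (- alpha).
Proof.
have [n1 h1] := @lower_tail R Delta gamma A hgamma hA.
have [n2 h2] := @upper_tail R Delta alpha halpha.
exists (maxn n1 n2) => T e se _ dD; rewrite geq_max => /andP[n1T n2T].
split; first exact: h1.
apply: le_trans (h2 T e se dD n2T) _; rewrite ler_peMl ?powR_ge0//; lra.
Qed.
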